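(* Let $R$ be a commutative unital ring, let $X$ be a subshift over a non-empty alphabet $\mathscr{A}$, and let $\widetilde{\mathcal{A}}_R(X)$ be its unital subshift algebra. Let $x\in\widetilde{\mathcal{A}}_R(X)$ be a non-zero element. Then there exist $\mu,\nu\in\widetilde{\mathcal{A}}_R(X)$ such that $\mu x\nu\neq 0$ and either: (1) $\mu x\nu=\gamma p_D$ with $D\in\mathcal{U}$ and $\gamma\in R\setminus\{0\}$; or (2) $\mu x\nu=\gamma_1 p_A+\sum_{i=2}^k\gamma_i s_{\beta^{q_i}}p_A$, where $(A,\beta)$ is a minimal cycle without exit, $q_i\in\mathbb{N}\setminus\{0\}$, and $\gamma_i\in R\setminus\{0\}$ for $i=1,\ldots,k$.
   Context: Conventions: $\mathbb{N}=\{0,1,2,\ldots\}$. $\mathscr{A}$ is a non-empty (possibly infinite) set, the alphabet; $\mathscr{A}^*$ is the set of finite words over $\mathscr{A}$, $\omega$ the empty word, $|\alpha|$ the length of a word, $\beta\alpha$ concatenation, $\alpha^n$ the $n$-fold concatenation, and $\alpha^\infty=\alpha\alpha\alpha\cdots$. A subshift $X\subseteq\mathscr{A}^{\mathbb{N}}$ is a set of the form $X=X_F$ for some $F\subseteq\mathscr{A}^*$, where $X_F$ is the set of all sequences in $\mathscr{A}^{\mathbb{N}}$ containing no word of $F$ as a (consecutive) subword. The language $\mathcal{L}_X$ is the set of all finite words (including $\omega$) that appear in some sequence of $X$. For $\alpha,\beta\in\mathcal{L}_X$ let $C(\alpha,\beta)=\{\beta x\in X:\alpha x\in X\}$; note $X=C(\omega,\omega)$.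 $\mathcal{U}$ is the Boolean algebra of subsets of $X$ generated by all $C(\alpha,\beta)$, $\alpha,\beta\in\mathcal{L}_X$. The unital subshift algebra $\widetilde{\mathcal{A}}_R(X)$ is the universal unital $R$-algebra with generators $\{p_A:A\in\mathcal{U}\}$ and $\{s_a,s_a^*:a\in\mathscr{A}\}$ subject to: (i) $p_X=1$, $p_{A\cap B}=p_Ap_B$, $p_{A\cup B}=p_A+p_B-p_{A\cap B}$, $p_\emptyset=0$ for all $A,B\in\mathcal{U}$; (ii) $s_as_a^*s_a=s_a$ and $s_a^*s_as_a^*=s_a^*$ for all $a\in\mathscr{A}$; (iii) $s_\beta s_\alpha^*s_\alpha s_\beta^*=p_{C(\alpha,\beta)}$ for all $\alpha,\beta\in\mathcal{L}_X$, where $s_\omega=s_\omega^*=1$ and, for $\alpha=\alpha(1)\cdots\alpha(n)$, $s_\alpha=s_{\alpha(1)}\cdots s_{\alpha(n)}$ and $s_\alpha^*=s_{\alpha(n)}^*\cdots s_{\alpha(1)}^*$. For $A\in\mathcal{U}$ and $\alpha\in\mathcal{L}_X$ the relative range is $r(A,\alpha)=\{x\in X:\alpha x\in A\}$. A cycle is a pair $(A,\alpha)$ with $\alpha\in\mathcal{L}_X\setminus\{\omega\}$, $\emptyset\neq A\in\mathcal{U}$ and $A\subseteq r(A,\alpha)$. A cycle $(A,\alpha)$ has an exit if $A\neq\{\alpha^\infty\}$; it is a cycle without exit if $A=\{\alpha^\infty\}$. A cycle without exit $(A,\alpha)$ is minimal if there is no $\beta\in\mathcal{L}_X$ with $1\leq|\beta|<|\alpha|$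 such that $\alpha=\beta^k$ for some $k\geq 2$.
   Formalization: The formal theorem additionally assumes that every letter of the alphabet occurs in X; otherwise, for X non-empty and R non-zero, a letter a not occurring in X gives a non-zero s_a for which no such μ, ν exist, so the claim fails as stated. *)

(* Defs.v *)
From HB Require Import structures.
From mathcomp Require Import all_boot all_order all_algebra generic_quotient.
From mathcomp Require Import boolp classical_sets.

Set Implicit Arguments.
Unset Strict Implicit.
Unset Printing Implicit Defensive.

Import GRing.Theory.

Local Open Scope classical_set_scope.
Local Open Scope quotient_scope.
Local Open Scope ring_scope.

(* A non-empty alphabet is a [pointedType]; words are [seq A]. *)
Section Words.
Variable A : pointedType.
Implicit Types (w a b : seq A) (x : nat -> A).

Definition occurs w x : Prop :=
  exists i : nat, w = [seq x (i + j)%N | j <- iota 0 (size w)].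

Definition shift_of (F : set (seq A)) : set (nat -> A) :=
  [set x | forall w, F w -> ~ occurs w x].

Definition subshift (X : set (nat -> A)) : Prop :=
  exists F : set (seq A), X = shift_of F.

(* The explicit disjunct only matters for the empty subshift. *)
Definition language (X : set (nat -> A)) : set (seq A) :=
  [set w | w = [::] \/ exists x, X x /\ occurs w x].

(* The infinite word w x: beyond the end of w, [nth] falls back on x. *)
Definition wcat w x : nat -> A := fun n => nth (x (n - size w)%N) w n.

Definition wpow w (k : nat) : seq A := flatten (nseq k w).

(* w^infinity; meaningful only for w != [::]. *)
Definition winfty w : nat -> A := fun n => nth point w (n %% size w).

Variable X : set (nat -> A).

Definition Cset a b : set (nat -> A) :=
  [set wcat b x | x in [set x | X (wcat b x) /\ X (wcat a x)]].

Inductive inU : set (nat -> A) -> Prop :=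
| inU_C a b : language X a -> language X b -> inU (Cset a b)
| inU_X : inU X
| inU_0 : inU set0
| inU_I B C : inU B -> inU C -> inU (B `&` C)
| inU_U B C : inU B -> inU C -> inU (B `|` C)
| inU_D B : inU B -> inU (X `\` B).

Record Uset : Type := USet { uset :> set (nat -> A); usetP : inU uset }.

Definition UsetX : Uset := USet inU_X.
Definition Uset0 : Uset := USet inU_0.
Definition UsetI (B C : Uset) : Uset := USet (inU_I (usetP B) (usetP C)).
Definition UsetU (B C : Uset) : Uset := USet (inU_U (usetP B) (usetP C)).
Definition UsetC a b (ha : language X a) (hb : language X b) : Uset :=
  USet (inU_C ha hb).

Definition rel_range (B : set (nat -> A)) a : set (nat -> A) :=
  [set x | X x /\ B (wcat a x)].

Definition is_cycle (B : Uset) a : Prop :=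
  [/\ language X a, a <> [::], uset B <> set0 & uset B `<=` rel_range B a].

Definition cycle_without_exit (B : Uset) a : Prop :=
  is_cycle B a /\ uset B = [set winfty a].

Definition minimal_cycle_without_exit (B : Uset) a : Prop :=
  cycle_without_exit B a /\
  ~ exists b, [/\ language X b, (1 <= size b)%N, (size b < size a)%N
                & exists k : nat, (2 <= k)%N /\ a = wpow b k].

End Words.

(* The algebra is built as formal algebra expressions in the generators, modulo
   the smallest congruence containing the axioms of unital associative
   R-algebras and the defining relations. *)
Section Algebra.
Variables (R : comPzRingType) (A : pointedType) (X : set (nat -> A)).

Inductive term : Type :=
| TProj of Uset X
| TGen of A
| TGenStar of A
| TZero
| TOne
| TOpp of term
| TAdd of term & term
| TMul of term & term
| TScale of R & term.

Definition tword (w : seq A) : term := foldr TMul TOne (map TGen w).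
Definition twordstar (w : seq A) : term :=
  foldr TMul TOne (map TGenStar (rev w)).

Inductive defining_rel : term -> term -> Prop :=
| rel_projX : defining_rel (TProj (UsetX X)) TOne
| rel_projI B C :
    defining_rel (TProj (UsetI B C)) (TMul (TProj B) (TProj C))
| rel_projU B C :
    defining_rel (TProj (UsetU B C))
      (TAdd (TAdd (TProj B) (TProj C)) (TOpp (TProj (UsetI B C))))
| rel_proj0 : defining_rel (TProj (Uset0 X)) TZero
| rel_gen a :
    defining_rel (TMul (TMul (TGen a) (TGenStar a)) (TGen a)) (TGen a)
| rel_genstar a :
    defining_rel (TMul (TMul (TGenStar a) (TGen a)) (TGenStar a)) (TGenStar a)
| rel_C a b (ha : language X a) (hb : language X b) :
    defining_rel
      (TMul (TMul (TMul (tword b) (twordstar a)) (tword a)) (twordstar b))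
      (TProj (UsetC ha hb)).

Inductive teq : term -> term -> Prop :=
| teq_rel t u : defining_rel t u -> teq t u
| teq_refl t : teq t t
| teq_sym t u : teq t u -> teq u t
| teq_trans t u v : teq t u -> teq u v -> teq t v
| teq_opp t t' : teq t t' -> teq (TOpp t) (TOpp t')
| teq_add t t' u u' : teq t t' -> teq u u' -> teq (TAdd t u) (TAdd t' u')
| teq_mul t t' u u' : teq t t' -> teq u u' -> teq (TMul t u) (TMul t' u')
| teq_scale c t t' : teq t t' -> teq (TScale c t) (TScale c t')
| teq_addA t u v : teq (TAdd t (TAdd u v)) (TAdd (TAdd t u) v)
| teq_addC t u : teq (TAdd t u) (TAdd u t)
| teq_add0 t : teq (TAdd TZero t) t
| teq_addN t : teq (TAdd (TOpp t) t) TZero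
| teq_mulA t u v : teq (TMul t (TMul u v)) (TMul (TMul t u) v)
| teq_mul1l t : teq (TMul TOne t) t
| teq_mul1r t : teq (TMul t TOne) t
| teq_mulDl t u v : teq (TMul (TAdd t u) v) (TAdd (TMul t v) (TMul u v))
| teq_mulDr t u v : teq (TMul t (TAdd u v)) (TAdd (TMul t u) (TMul t v))
| teq_scaleA c d t : teq (TScale c (TScale d t)) (TScale (c * d) t)
| teq_scale1 t : teq (TScale 1 t) t
| teq_scaleDr c t u : teq (TScale c (TAdd t u)) (TAdd (TScale c t) (TScale c u))
| teq_scaleDl c d t : teq (TScale (c + d) t) (TAdd (TScale c t) (TScale d t))
| teq_scaleAl c t u : teq (TScale c (TMul t u)) (TMul (TScale c t) u)
| teq_scaleAr c t u : teq (TScale c (TMul t u)) (TMul t (TScale c u)).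

HB.instance Definition _ := gen_eqMixin term.
HB.instance Definition _ := gen_choiceMixin term.

Definition teqb : rel term := fun t u => `[< teq t u >].

Lemma teqb_refl : reflexive teqb.
Proof. by move=> t; apply/asboolP; exact: teq_refl. Qed.

Lemma teqb_sym : symmetric teqb.
Proof. by move=> t u; apply: asbool_equiv_eq; split; exact: teq_sym. Qed.

Lemma teqb_trans : transitive teqb.
Proof.
move=> u t v /asboolP tu /asboolP uv.
by apply/asboolP; exact: teq_trans tu uv.
Qed.

Canonical teq_equiv := EquivRel teqb teqb_refl teqb_sym teqb_trans.

Definition subshift_alg : Type := {eq_quot teq_equiv}.
HB.instance Definition _ := Choice.on subshift_alg.

Definition tclass (t : term) : subshift_alg := \pi_{eq_quot teq_equiv} t.
Definition trepr (x : subshift_alg) : term := repr (x : {eq_quot teq_equiv}).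

Lemma treprK x : tclass (trepr x) = x.
Proof. exact: reprK. Qed.

Lemma tclassP t u : tclass t = tclass u <-> teq t u.
Proof.
split=> [/eqP|tu]; first by rewrite /tclass eqmodE => /asboolP.
by apply/eqP; rewrite /tclass eqmodE; apply/asboolP.
Qed.

Lemma trepr_teq t : teq (trepr (tclass t)) t.
Proof. by apply/tclassP; rewrite treprK. Qed.

Definition aopp x := tclass (TOpp (trepr x)).
Definition aadd x y := tclass (TAdd (trepr x) (trepr y)).
Definition amul x y := tclass (TMul (trepr x) (trepr y)).
Definition ascale c x := tclass (TScale c (trepr x)).

Lemma tclass_opp t : aopp (tclass t) = tclass (TOpp t).
Proof. by apply/tclassP/teq_opp/trepr_teq. Qed.

Lemma tclass_add t u : aadd (tclass t) (tclass u) = tclass (TAdd t u).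
Proof. by apply/tclassP/teq_add; exact: trepr_teq. Qed.

Lemma tclass_mul t u : amul (tclass t) (tclass u) = tclass (TMul t u).
Proof. by apply/tclassP/teq_mul; exact: trepr_teq. Qed.

Lemma tclass_scale c t : ascale c (tclass t) = tclass (TScale c t).
Proof. by apply/tclassP/teq_scale/trepr_teq. Qed.

Let tE := (tclass_opp, tclass_add, tclass_mul, tclass_scale).

Fact aaddA : associative aadd.
Proof.
move=> x y z; rewrite -[x]treprK -[y]treprK -[z]treprK !tE.
by apply/tclassP; exact: teq_addA.
Qed.

Fact aaddC : commutative aadd.
Proof.
move=> x y; rewrite -[x]treprK -[y]treprK !tE.
by apply/tclassP; exact: teq_addC.
Qed.

Fact aadd0 : left_id (tclass TZero) aadd.
Proof. by move=> x; rewrite -[x]treprK !tE; apply/tclassP; exact: teq_add0. Qed.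

Fact aaddN : left_inverse (tclass TZero) aopp aadd.
Proof. by move=> x; rewrite -[x]treprK !tE; apply/tclassP; exact: teq_addN. Qed.

HB.instance Definition _ :=
  GRing.isZmodule.Build subshift_alg aaddA aaddC aadd0 aaddN.

Fact amulA : associative amul.
Proof.
move=> x y z; rewrite -[x]treprK -[y]treprK -[z]treprK !tE.
by apply/tclassP; exact: teq_mulA.
Qed.

Fact amul1l : left_id (tclass TOne) amul.
Proof. by move=> x; rewrite -[x]treprK !tE; apply/tclassP; exact: teq_mul1l. Qed.

Fact amul1r : right_id (tclass TOne) amul.
Proof. by move=> x; rewrite -[x]treprK !tE; apply/tclassP; exact: teq_mul1r. Qed.

Fact amulDl : left_distributive amul (@GRing.add subshift_alg).
Proof.
move=> x y z; change (amul (aadd x y) z = aadd (amul x z) (amul y z)).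
rewrite -[x]treprK -[y]treprK -[z]treprK !tE.
by apply/tclassP; exact: teq_mulDl.
Qed.

Fact amulDr : right_distributive amul (@GRing.add subshift_alg).
Proof.
move=> x y z; change (amul x (aadd y z) = aadd (amul x y) (amul x z)).
rewrite -[x]treprK -[y]treprK -[z]treprK !tE.
by apply/tclassP; exact: teq_mulDr.
Qed.

(* [algType] excludes the zero algebra, which does occur here (X = set0, or R
   trivial): the ring and module structures are therefore kept separate. *)
HB.instance Definition _ :=
  GRing.Zmodule_isPzRing.Build subshift_alg amulA amul1l amul1r amulDl amulDr.

Fact ascaleA c d x : ascale c (ascale d x) = ascale (c * d) x.
Proof. by rewrite -[x]treprK !tE; apply/tclassP; exact: teq_scaleA. Qed.

Fact ascale1 : left_id 1 ascale.
Proof. by move=> x; rewrite -[x]treprK !tE; apply/tclassP; exact: teq_scale1. Qed.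

Fact ascaleDr : right_distributive ascale +%R.
Proof.
move=> c x y; change (ascale c (aadd x y) = aadd (ascale c x) (ascale c y)).
rewrite -[x]treprK -[y]treprK !tE.
by apply/tclassP; exact: teq_scaleDr.
Qed.

Fact ascaleDl x : {morph ascale^~ x : c d / c + d}.
Proof.
move=> c d; change (ascale (c + d) x = aadd (ascale c x) (ascale d x)).
by rewrite -[x]treprK !tE; apply/tclassP; exact: teq_scaleDl.
Qed.

HB.instance Definition _ :=
  GRing.Zmodule_isLmodule.Build R subshift_alg ascaleA ascale1 ascaleDr ascaleDl.

Lemma subshift_scalerAl (c : R) (x y : subshift_alg) :
  c *: (x * y) = (c *: x) * y.
Proof.
change (ascale c (amul x y) = amul (ascale c x) y).
by rewrite -[x]treprK -[y]treprK !tE; apply/tclassP; exact: teq_scaleAl.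
Qed.

Lemma subshift_scalerAr (c : R) (x y : subshift_alg) :
  c *: (x * y) = x * (c *: y).
Proof.
change (ascale c (amul x y) = amul x (ascale c y)).
by rewrite -[x]treprK -[y]treprK !tE; apply/tclassP; exact: teq_scaleAr.
Qed.

Definition proj (B : Uset X) : subshift_alg := tclass (TProj B).
Definition gen (a : A) : subshift_alg := tclass (TGen a).
Definition genstar (a : A) : subshift_alg := tclass (TGenStar a).
Definition genw (w : seq A) : subshift_alg := \prod_(a <- w) gen a.

Section UniversalProperty.
Variables (B : algType R) (p : Uset X -> B) (s s' : A -> B).

Fixpoint teval (t : term) : B :=
  match t with
  | TProj C => p C
  | TGen a => s a
  | TGenStar a => s' a
  | TZero => 0
  | TOne => 1
  | TOpp t => - teval t
  | TAdd t u => teval t + teval u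
  | TMul t u => teval t * teval u
  | TScale c t => c *: teval t
  end.

Hypothesis rels : forall t u, defining_rel t u -> teval t = teval u.

Lemma teval_teq t u : teq t u -> teval t = teval u.
Proof.
elim=> {t u} /=.
- exact: rels.
- by [].
- by move=> t u _ ->.
- by move=> t u v _ -> _ ->.
- by move=> t t' _ ->.
- by move=> t t' u u' _ -> _ ->.
- by move=> t t' u u' _ -> _ ->.
- by move=> c t t' _ ->.
- by move=> *; rewrite addrA.
- by move=> *; rewrite addrC.
- by move=> *; rewrite add0r.
- by move=> *; rewrite addNr.
- by move=> *; rewrite mulrA.
- by move=> *; rewrite mul1r.
- by move=> *; rewrite mulr1.
- by move=> *; rewrite mulrDl.
- by move=> *; rewrite mulrDr.
- by move=> *; rewrite scalerA.
- by move=> *; rewrite scale1r.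
- by move=> *; rewrite scalerDr.
- by move=> *; rewrite scalerDl.
- by move=> *; rewrite scalerAl.
- by move=> *; rewrite scalerAr.
Qed.

Lemma subshift_alg_universal :
  exists! f : subshift_alg -> B,
    [/\ linear f, monoid_morphism f, forall C, f (proj C) = p C,
        forall a, f (gen a) = s a & forall a, f (genstar a) = s' a].
Proof.
exists (fun x => teval (trepr x)); split.
  split=> [c x y||C|a|a]; try exact: (teval_teq (trepr_teq _)).
    change (teval (trepr (aadd (ascale c x) y)) =
            c *: teval (trepr x) + teval (trepr y)).
    rewrite -[x]treprK -[y]treprK !tE !treprK.
    exact: (teval_teq (trepr_teq _)).
  split; first exact: (teval_teq (trepr_teq TOne)).
  move=> x y; exact: (teval_teq (trepr_teq (TMul (trepr x) (trepr y)))).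
move=> f [fL [f1 fM] fp fs fs'].
have f0 : f 0 = 0.
  have := fL (-1) 0 0.
  by rewrite scaleN1r addNr scaleN1r addNr.
have fD x y : f (x + y) = f x + f y.
  by have := fL 1 x y; rewrite !scale1r.
have fZ c x : f (c *: x) = c *: f x.
  by have := fL c x 0; rewrite !addr0 f0 addr0.
apply: funext => x; rewrite -[in RHS](treprK x).
elim: (trepr x) => /=.
- by move=> C; rewrite -fp.
- by move=> a; rewrite -fs.
- by move=> a; rewrite -fs'.
- by rewrite -f0.
- by rewrite -f1.
- by move=> t ->; rewrite -scaleN1r -fZ scaleN1r -tclass_opp.
- by move=> t -> u ->; rewrite -fD -tclass_add.
- by move=> t -> u ->; rewrite -fM -tclass_mul.
- by move=> c t ->; rewrite -fZ -tclass_scale.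
Qed.

End UniversalProperty.
End Algebra.

(* Main.v *)
(* Let x <> 0. Every element is a combination of monomials s_u p_B s_v^*. If
   x s_a = 0 for all letters a, then right multiplication by the
   complement of finitely many cylinders fixes x and kills all its monomials
   with v nonempty;
   otherwise some x s_a <> 0 has shorter starred words. So some multiple of x is
   a nonzero combination of terms s_u p_B. Cutting down to a small D makes it
   sum_u g_u s_u p_D with distinct u, and s_w^* for a shortest w turns it into
   g p_D + sum_i g_i s_(e_i) p_D with g <> 0 and all e_i nonempty. If D contains
   a point different from all e_i^infinity, compressing by a cylinder around it
   leaves g p_D'. Otherwise D is finite; compressing to a single point t of D
   leaves only the e_i that fix t, which are powers of the shortest word fixing
   t. That the result is nonzero is seen on functions on X x Z: its degree-zero
   part multiplies by g on D. *)
Require Import Defs.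
From HB Require Import structures.
From mathcomp Require Import all_boot all_order all_algebra.
From mathcomp Require Import boolp classical_sets.

Set Implicit Arguments.
Unset Strict Implicit.
Unset Printing Implicit Defensive.

Import GRing.Theory.

Local Open Scope classical_set_scope.
Local Open Scope ring_scope.

(** * Infinite words, periodic points, and relative ranges in a subshift *)

Section InfiniteWords.
Variable A : pointedType.
Implicit Types (w a b : seq A) (x y : nat -> A).

Lemma wcatE w x n :
  wcat w x n = if (n < size w)%N then nth point w n else x (n - size w)%N.
Proof.
rewrite /wcat; case: ltnP => h; first exact: set_nth_default.
by rewrite nth_default.
Qed.

Lemma wcat_nil x : wcat [::] x = x.
Proof. by apply/funext => n; rewrite wcatE subn0. Qed.

Lemma wcat_cat a b x : wcat (a ++ b) x = wcat a (wcat b x).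
Proof.
apply/funext => n; rewrite !wcatE size_cat nth_cat.
case: (ltnP n (size a)) => h; first by rewrite (leq_trans h (leq_addr _ _)).
by rewrite ltn_subLR // subnDA.
Qed.

Lemma wcat_cons (c : A) w x : wcat (c :: w) x = wcat [:: c] (wcat w x).
Proof. by rewrite -wcat_cat. Qed.

Definition prefix_of x n : seq A := mkseq x n.
Definition shiftn n x : nat -> A := fun k => x (n + k)%N.

Lemma size_prefix_of x n : size (prefix_of x n) = n.
Proof. exact: size_mkseq. Qed.

Lemma nth_prefix_of x n k : (k < n)%N -> nth point (prefix_of x n) k = x k.
Proof. exact: nth_mkseq. Qed.

Lemma shiftn_wcat w x : shiftn (size w) (wcat w x) = x.
Proof.
by apply/funext => n; rewrite /shiftn wcatE ltnNge leq_addr /= addKn.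
Qed.

Lemma wcat_inj w x y : wcat w x = wcat w y -> x = y.
Proof. by move=> h; rewrite -(shiftn_wcat w x) h shiftn_wcat. Qed.

Lemma prefix_of_wcat w x : prefix_of (wcat w x) (size w) = w.
Proof.
apply: (@eq_from_nth _ point); first by rewrite size_prefix_of.
by move=> i; rewrite size_prefix_of => h; rewrite nth_prefix_of // wcatE h.
Qed.

Lemma wcat_prefix_of x n : wcat (prefix_of x n) (shiftn n x) = x.
Proof.
apply/funext => k; rewrite wcatE size_prefix_of.
by case: ltnP => h; [rewrite nth_prefix_of | rewrite /shiftn subnKC].
Qed.

Lemma occurs_wcat w u x : occurs w x -> occurs w (wcat u x).
Proof.
move=> [i e]; exists (size u + i)%N; rewrite {1}e; apply: eq_map => j.
by rewrite -[in LHS](shiftn_wcat u x) /shiftn addnA.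
Qed.

Lemma occurs_prefix w x : occurs w (wcat w x).
Proof.
exists 0%N; apply: (@eq_from_nth _ point); first by rewrite size_map size_iota.
move=> i hi; rewrite (nth_map 0%N) ?size_iota // nth_iota //.
by rewrite !add0n wcatE hi.
Qed.

(** The equation determines each letter beyond the first [size w] from the letter [size w] places
    earlier, hence the strong induction on the index. *)
Lemma winftyE w x : w <> [::] -> wcat w x = x -> x = winfty w.
Proof.
move=> w0 wx; apply/funext => n.
have sw : (0 < size w)%N by case: w w0 {wx}.
elim/ltn_ind: n => n IH; rewrite -wx wcatE /winfty.
case: ltnP => h; first by rewrite modn_small.
rewrite IH /winfty; last by rewrite ltn_subrL sw (leq_trans sw h).
by rewrite -[in RHS](subnK h) modnDr.
Qed.

Lemma wcat_winfty w : w <> [::] -> wcat w (winfty w) = winfty w.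
Proof.
move=> w0; apply/funext => n; rewrite wcatE /winfty; case: ltnP => h.
  by rewrite modn_small.
by rewrite -[in RHS](subnK h) modnDr.
Qed.

Lemma wpowS w k : wpow w k.+1 = w ++ wpow w k.
Proof. by []. Qed.

Lemma size_wpow w k : size (wpow w k) = (k * size w)%N.
Proof. by elim: k => [|k IH]; rewrite ?mul0n // wpowS size_cat IH mulSn. Qed.

Lemma wcat_wpow w k x : wcat w x = x -> wcat (wpow w k) x = x.
Proof.
by move=> e; elim: k => [|k IH]; rewrite ?wcat_nil // wpowS wcat_cat IH.
Qed.

Lemma winfty_wpow w k : (0 < k)%N -> w <> [::] ->
  winfty (wpow w k) = winfty w.
Proof.
move=> k0 w0; apply/esym/winftyE; last exact/wcat_wpow/wcat_winfty.
by case: k k0 => // k _; rewrite wpowS; case: w w0.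
Qed.

(** [b] is a shortest non-empty word fixing [x]. Any other fixing word [c] is a power of [b]
    followed by a remainder shorter than [b]; cancelling the power shows that the remainder also
    fixes [x], so it is empty. *)
Lemma primitive_root x w : w <> [::] -> wcat w x = x ->
  exists b, [/\ b <> [::], wcat b x = x &
    (forall c, c <> [::] -> wcat c x = x -> (size b <= size c)%N) /\
    forall c, c <> [::] -> wcat c x = x ->
      exists2 q, q <> 0%N & c = wpow b q].
Proof.
move=> w0 wx.
pose P n := `[< exists c, [/\ c <> [::], wcat c x = x & size c = n] >].
have exP : exists n, P n by exists (size w); apply/asboolP; exists w.
case: (ex_minnP exP) => n /asboolP[b [b0 bx <-]] bmin.
have bmin' c : c <> [::] -> wcat c x = x -> (size b <= size c)%N.
  by move=> c0 cx; apply: bmin; apply/asboolP; exists c.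
exists b; split=> //; split=> // c c0 cx.
have sb : (0 < size b)%N by case: b b0 {bx bmin bmin'}.
pose q := (size c %/ size b)%N; pose r := (size c %% size b)%N.
have e : size c = (size (wpow b q) + r)%N by rewrite size_wpow -divn_eq.
(* Both sides are prefixes of [x] of the same length. *)
have cE : take (size (wpow b q)) c = wpow b q.
  apply: (@eq_from_nth _ point).
    by rewrite size_takel // e leq_addr.
  rewrite size_takel => [i hi|]; last by rewrite e leq_addr.
  rewrite nth_take // -[LHS](_ : wcat c x i = _); last first.
    by rewrite wcatE e (leq_trans hi (leq_addr _ _)).
  by rewrite cx -{1}(wcat_wpow q bx) wcatE hi.
pose d := drop (size (wpow b q)) c.
have cd : c = wpow b q ++ d by rewrite -cE /d cat_take_drop.
have dx : wcat d x = x.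
  apply: (@wcat_inj (wpow b q)); rewrite -wcat_cat -cd cx.
  by rewrite wcat_wpow.
have sd : (size d < size b)%N by rewrite size_drop e addKn ltn_mod.
case: (eqVneq d [::]) => [d0|/eqP d0]; last first.
  by have := bmin' _ d0 dx; rewrite leqNgt sd.
exists q; last by rewrite cd d0 cats0.
by move=> q0; apply: c0; rewrite cd d0 q0.
Qed.

(** Each [winfty v] different from [y] differs from it at some letter, and the finitely many such
    positions have a common bound. Being distinct from finitely many periodic points thus becomes a
    condition on a cylinder. *)
Lemma separating_length (E : seq (seq A)) y :
  exists N, forall w, w \in E ->
    (forall k, (k < N)%N -> y k = winfty w k) -> y = winfty w.
Proof.
elim: E => [|v E [N IH]]; first by exists 0%N.
have [e|ne] := pselect (y = winfty v).
  by exists N => w; rewrite in_cons => /orP[/eqP->|/IH].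
have [n hn] : exists n, y n <> winfty v n.
  by apply: contrapT => h; apply: ne; apply/funext => n; apply: contrapT => h';
    apply: h; exists n.
exists (maxn n.+1 N) => w; rewrite in_cons => /orP[/eqP-> h|/IH hw h].
  by case: hn; apply: h; rewrite leq_max ltnSn.
by apply: hw => k hk; apply: h; rewrite leq_max hk orbT.
Qed.

(** A finite form of [winftyE]: if a cylinder around [y] contains both [z] and [wcat w z], the
    letters of [y] inside it repeat with period [size w]. *)
Lemma winfty_prefix w y z N : w <> [::] ->
  (forall k, (k < N)%N -> z k = y k) ->
  (forall k, (k < N)%N -> wcat w z k = y k) ->
  forall k, (k < N)%N -> y k = winfty w k.
Proof.
move=> w0 zy wzy k; have sw : (0 < size w)%N by case: w w0 {wzy}.
elim/ltn_ind: k => k IH kN; rewrite -wzy // wcatE /winfty.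
case: ltnP => h; first by rewrite modn_small.
have hk : (k - size w < k)%N by rewrite ltn_subrL sw (leq_trans sw h).
have hkN := ltn_trans hk kN.
by rewrite zy // IH // /winfty -[in RHS](subnK h) modnDr.
Qed.

Variable X : set (nat -> A).
Hypothesis hX : subshift X.

(** A forbidden word occurring in the tail would occur in the whole sequence. *)
Lemma subshift_wcat w x : X (wcat w x) -> X x.
Proof. by case: hX => F -> h v /h h' /(@occurs_wcat _ w). Qed.

Lemma language_prefix w x : X (wcat w x) -> language X w.
Proof. by move=> h; right; exists (wcat w x); split=> //; exact: occurs_prefix. Qed.

Lemma inU_sub B : inU X B -> B `<=` X.
Proof.
elim=> {B} //.
- by move=> a b _ _ x [y [? ?] <-].
- by move=> B C _ hB _ _ x [/hB].
- by move=> B C _ hB _ hC x [/hB|/hC].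
Qed.

Lemma rel_rangeX w x : rel_range X X w x <-> X (wcat w x).
Proof. by split=> [[]|h] //; split=> //; exact: subshift_wcat h. Qed.

Lemma Cset_r w : Cset X w [::] = rel_range X X w.
Proof.
apply/seteqP; split=> x.
  by move=> [y [yX wyX] <-]; rewrite wcat_nil in yX *.
by move=> [xX wxX]; exists x => /=; rewrite wcat_nil.
Qed.

Lemma rel_range_nil B : B `<=` X -> rel_range X B [::] = B.
Proof.
by move=> BX; apply/seteqP; split=> x; rewrite /rel_range /= wcat_nil; [case|auto].
Qed.

Lemma rel_range_cat B a b : B `<=` X ->
  rel_range X (rel_range X B a) b = rel_range X B (a ++ b).
Proof.
move=> BX; apply/seteqP; split=> x; rewrite /rel_range /= wcat_cat.
  by case=> ? [].
by case=> hx hB; split=> //; split=> //; exact: (subshift_wcat (BX _ hB)).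
Qed.

End InfiniteWords.
(* The action of the algebra on R-valued functions on X x Z, in which the
   integer records the degree of an element; functions are totalised by 0
   outside of X. *)
Section Representation.
Variables (R : comPzRingType) (A : pointedType) (X : set (nat -> A)).
Hypothesis hX : subshift X.
Implicit Types (t u : term R X) (y : nat -> A) (n : int) (w : seq A).

Definition fn : Type := (nat -> A) -> int -> R.
Implicit Type phi : fn.

Fixpoint act t phi : fn := fun y n =>
  match t with
  | TProj B => if `[< uset B y >] then phi y n else 0
  | TGen a => if `[< X y >] && (y 0%N == a) then phi (shiftn 1 y) (n - 1) else 0
  | TGenStar a => if `[< X y >] then phi (wcat [:: a] y) (n + 1) else 0
  | TZero => 0
  | TOne => phi y n
  | TOpp t => - act t phi y n
  | TAdd t u => act t phi y n + act u phi y n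
  | TMul t u => act t (act u phi) y n
  | TScale c t => c * act t phi y n
  end.

(** The relation p_X = 1 holds for the action only on functions vanishing outside [X], so these
    carry the representation. *)
Definition supported phi := forall y n, ~ X y -> phi y n = 0.

Lemma act_supported t phi : supported phi -> supported (act t phi).
Proof.
elim: t phi => [B|a|a|||t IH|t IHt u IHu|t IHt u IHu|c t IH] phi hphi y n nXy //=.
- by case: asboolP => // /(inU_sub (usetP B)).
- by rewrite asboolF.
- by rewrite asboolF.
- exact: hphi.
- by rewrite IH ?oppr0.
- by rewrite IHt ?IHu ?addr0.
- by rewrite IHt //; exact: IHu.
- by rewrite IH ?mulr0.
Qed.

(** Makes the action respect [teq_mulDr]; [act_scale] does the same for [teq_scaleAr]. *)
Lemma act_add t phi psi :
  act t (fun y n => phi y n + psi y n) = fun y n => act t phi y n + act t psi y n.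
Proof.
elim: t phi psi => [B|a|a|||t IH|t IHt u IHu|t IHt u IHu|c t IH] phi psi /=;
  apply/funext => y; apply/funext => n.
- by case: ifP => // _; rewrite addr0.
- by case: ifP => // _; rewrite addr0.
- by case: ifP => // _; rewrite addr0.
- by rewrite addr0.
- by [].
- by rewrite IH opprD.
- by rewrite IHt IHu addrACA.
- by rewrite IHu IHt.
- by rewrite IH mulrDr.
Qed.

Lemma act_scale t c phi :
  act t (fun y n => c * phi y n) = fun y n => c * act t phi y n.
Proof.
elim: t phi => [B|a|a|||t IH|t IHt u IHu|t IHt u IHu|d t IH] phi /=;
  apply/funext => y; apply/funext => n.
- by case: ifP => // _; rewrite mulr0.
- by case: ifP => // _; rewrite mulr0.
- by case: ifP => // _; rewrite mulr0.
- by rewrite mulr0.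
- by [].
- by rewrite IH mulrN.
- by rewrite IHt IHu mulrDr.
- by rewrite IHu IHt.
- by rewrite IH mulrCA.
Qed.

Lemma act_tword w phi y n : supported phi -> X y ->
  act (tword R X w) phi y n =
  if prefix_of y (size w) == w then phi (shiftn (size w) y) (n - (size w)%:Z)
  else 0.
Proof.
move=> hphi; elim: w y n => [|a w IH] y n Xy /=; first by rewrite subr0.
rewrite asboolT //= {1}/prefix_of /mkseq /= eqseq_cons.
case: eqP => //= _.
have Xy' : X (shiftn 1 y).
  by apply: (@subshift_wcat _ _ hX (prefix_of y 1)); rewrite wcat_prefix_of.
rewrite IH // /prefix_of /mkseq (iotaDl 1 0) -map_comp.
by rewrite intS opprD addrA.
Qed.

Lemma act_twordstar w phi y n : supported phi -> X y ->
  act (twordstar R X w) phi y n = phi (wcat w y) (n + (size w)%:Z).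
Proof.
move=> hphi Xy; elim: w n phi hphi => [|a w IH] n phi hphi.
  by rewrite wcat_nil addr0.
(* Starred words are reversed, so the star of the first letter is innermost and acts first. *)
have -> : act (twordstar R X (a :: w)) phi =
          act (twordstar R X w) (act (TGenStar R X a) phi).
  rewrite /twordstar rev_cons map_rcons.
  elim: (map _ _) (phi) => //= t s IHs psi.
  by rewrite IHs.
rewrite IH; last exact: act_supported.
rewrite /= (wcat_cons a w y); case: asboolP => h.
  by rewrite -addrA -PoszD addn1.
by rewrite hphi // => /(subshift_wcat hX).
Qed.

Lemma defining_rel_act t u : defining_rel t u ->
  forall phi, supported phi -> act t phi = act u phi.
Proof.
case=> {t u}.
- move=> phi hphi; apply/funext => y; apply/funext => n /=.
  by case: asboolP => // h; rewrite hphi.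
- move=> B C phi hphi; apply/funext => y; apply/funext => n /=.
  by rewrite asbool_and; case: asboolP.
- move=> B C phi hphi; apply/funext => y; apply/funext => n /=.
  rewrite asbool_or asbool_and; case: asboolP; case: asboolP => _ _ //=;
  by rewrite ?oppr0 ?addr0 ?add0r ?addrK.
- move=> phi hphi; apply/funext => y; apply/funext => n /=.
  by rewrite asboolF.
- move=> a phi hphi; apply/funext => y; apply/funext => n /=.
  case: asboolP => //= Xy; case: eqP => //= ya.
  have ye : wcat [:: a] (shiftn 1 y) = y by rewrite -ya -[RHS](wcat_prefix_of y 1).
  have Xy' : X (shiftn 1 y) by apply: (@subshift_wcat _ _ hX [:: a]); rewrite ye.
  by rewrite asboolT // ye asboolT // ya eqxx /= subrK.
- move=> a phi hphi; apply/funext => y; apply/funext => n /=.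
  case: asboolP => //= Xy; case: asboolP => //= Xay; last by rewrite hphi.
  have ye : shiftn 1 (wcat [:: a] y) = y := shiftn_wcat [:: a] y.
  by rewrite eqxx /= ye asboolT // addrK.
(* Read from the left, the four factors strip [b] from [y], prepend [a] to the rest [z], strip [a]
   and restore [b]. The value is [phi y n] unless [y] does not start with [b] or [wcat a z] leaves
   [X]. *)
- move=> a b ha hb phi hphi; apply/funext => y; apply/funext => n.
  have aS t psi : supported psi -> supported (act t psi) by exact: act_supported.
  have [Xy|nXy] := pselect (X y); last first.
    by rewrite !(act_supported _ hphi n nXy).
  rewrite /= act_tword //; last exact/aS/aS/aS.
  case: eqP => yb; last first.
    rewrite asboolF // => -[z _ zy].
    by apply: yb; rewrite -zy prefix_of_wcat.
  set z := shiftn _ _.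
  have yz : wcat b z = y by rewrite -[RHS](wcat_prefix_of y (size b)) yb.
  have Xz : X z by apply: (@subshift_wcat _ _ hX b); rewrite yz.
  rewrite act_twordstar //; last exact/aS/aS.
  have [Xaz|nXaz] := pselect (X (wcat a z)); last first.
    rewrite (act_supported (tword R X a)) //; last exact: aS.
    rewrite asboolF // => -[z' [_ Xaz'] /= e]; apply: nXaz.
    by rewrite -yz in e; rewrite -(wcat_inj e).
  rewrite act_tword //; last exact: aS.
  rewrite prefix_of_wcat eqxx shiftn_wcat act_twordstar // yz addrK subrK.
  by rewrite asboolT //; exists z => //=; rewrite yz.
Qed.

Lemma teq_act t u : teq t u -> forall phi, supported phi -> act t phi = act u phi.
Proof.
elim=> {t u}.
- exact: defining_rel_act.
- by [].
- by move=> t u _ IH phi h; rewrite IH.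
- by move=> t u v _ IH _ IH' phi h; rewrite IH // IH'.
- by move=> t u _ IH phi h /=; rewrite IH.
- by move=> t t' u u' _ IH _ IH' phi h /=; rewrite IH // IH'.
- move=> t t' u u' _ IH _ IH' phi h /=; rewrite IH' // IH //.
  exact: act_supported.
- by move=> c t u _ IH phi h /=; rewrite IH.
- by move=> t u v phi h; do 2!apply/funext => ?; rewrite /= addrA.
- by move=> t u phi h; do 2!apply/funext => ?; rewrite /= addrC.
- by move=> t phi h; do 2!apply/funext => ?; rewrite /= add0r.
- by move=> t phi h; do 2!apply/funext => ?; rewrite /= addNr.
- by [].
- by [].
- by [].
- by [].
- by move=> t u v phi h; do 2!apply/funext => ?; rewrite /= act_add.
- by move=> c d t phi h; do 2!apply/funext => ?; rewrite /= mulrA.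
- by move=> t phi h; do 2!apply/funext => ?; rewrite /= mul1r.
- by move=> c t u phi h; do 2!apply/funext => ?; rewrite /= mulrDr.
- by move=> c d t phi h; do 2!apply/funext => ?; rewrite /= mulrDl.
- by [].
- by move=> c t u phi h; do 2!apply/funext => ?; rewrite /= act_scale.
Qed.

Definition coef (x : subshift_alg R X) (phi : fn) (y : nat -> A) (n : int) : R :=
  act (trepr x) phi y n.

Lemma coef_tclass t phi y n : supported phi -> coef (tclass t) phi y n = act t phi y n.
Proof. by move=> h; rewrite /coef (teq_act (trepr_teq t)). Qed.

Lemma tclassD t u : tclass t + tclass u = tclass (TAdd t u).
Proof. exact: tclass_add. Qed.

Lemma tclassM t u : tclass t * tclass u = tclass (TMul t u).
Proof. exact: tclass_mul. Qed.

Lemma tclassZ c t : c *: tclass t = tclass (TScale c t).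
Proof. exact: tclass_scale. Qed.

Lemma coefD x x' phi y n : supported phi ->
  coef (x + x') phi y n = coef x phi y n + coef x' phi y n.
Proof.
by move=> h; rewrite -{1}[x]treprK -{1}[x']treprK tclassD coef_tclass.
Qed.

Lemma coefZ c x phi y n : supported phi ->
  coef (c *: x) phi y n = c * coef x phi y n.
Proof. by move=> h; rewrite -{1}[x]treprK tclassZ coef_tclass. Qed.

Lemma coef0 phi y n : supported phi -> coef 0 phi y n = 0.
Proof. exact: (@coef_tclass (TZero R X)). Qed.

Lemma tclass_tword w : tclass (tword R X w) = genw R X w.
Proof.
rewrite /genw; elim: w => [|a w IH]; first by rewrite big_nil.
by rewrite big_cons -IH tclassM.
Qed.

Lemma coef_genw_proj w B phi y n : supported phi -> X y ->
  coef (genw R X w * proj R B) phi y n =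
  if (prefix_of y (size w) == w) && `[< uset B (shiftn (size w) y) >]
  then phi (shiftn (size w) y) (n - (size w)%:Z) else 0.
Proof.
move=> h Xy; rewrite -tclass_tword tclassM coef_tclass //= act_tword //; last
  exact: (@act_supported (TProj R B)).
by case: eqP => //=.
Qed.

(** The element acts on the indicator of X x {0} and is evaluated at [(y, 0)]: the first term gives
    [g], while a non-empty word [w] reads the indicator at level [- size w], where it vanishes. *)
Lemma neq0_of_degree0 (g : R) (D : Uset X) (s : seq (R * seq A)) y :
  g <> 0 -> uset D y -> (forall i, i \in [seq j.2 | j <- s] -> i <> [::]) ->
  g *: proj R D + \sum_(i <- s) i.1 *: (genw R X i.2 * proj R D) <> 0.
Proof.
move=> g0 Dy hs e; apply: g0.
have Xy : X y := inU_sub (usetP D) Dy.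
pose phi : fn := fun z n => if `[< X z >] && (n == 0) then 1 else 0.
have sphi : supported phi by move=> z n nX; rewrite /phi asboolF.
have := congr1 (fun x => coef x phi y 0) e.
rewrite coefD // coefZ // coef0 //.
have -> : coef (proj R D) phi y 0 = 1.
  by rewrite coef_tclass //= asboolT // /phi asboolT.
rewrite mulr1.
suff -> : coef (\sum_(i <- s) i.1 *: (genw R X i.2 * proj R D)) phi y 0 = 0.
  by rewrite addr0.
elim: s hs {e} => [|[c w] s IH] hs; first by rewrite big_nil coef0.
rewrite big_cons coefD // IH ?addr0 => [|i hi]; last first.
  by apply: hs; rewrite in_cons hi orbT.
rewrite coefZ // coef_genw_proj //=; case: ifP => _; last by rewrite mulr0.
case: w hs => [hs|a w _]; last by rewrite /phi sub0r oppr_eq0 andbF mulr0.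
by case: (hs [::]); rewrite // mem_head.
Qed.

End Representation.

(** * Consequences of the defining relations for projections and words *)

Section Relations.
Variables (R : comPzRingType) (A : pointedType) (X : set (nat -> A)).
Hypothesis hX : subshift X.
Implicit Types (B C D : Uset X) (a b : A) (w u v : seq A).

Local Notation p := (@proj R A X).
Local Notation s := (@gen R A X).
Local Notation s' := (@genstar R A X).
Local Notation sw := (@genw R A X).

Definition UsetD B : Uset X := USet (inU_D (usetP B)).
Definition UsetDI B C : Uset X := UsetI B (UsetD C).

(** The membership proof inside a [Uset] is irrelevant, so identities of sets become identities of
    projections. *)
Lemma proj_ext B C : uset B = uset C -> p B = p C.
Proof.
case: B C => [B hB] [C hC] /= e; move: hB hC; rewrite e => hB hC.
by rewrite (Prop_irrelevance hB hC).
Qed.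

Lemma defining_relP (t t' : term R X) : defining_rel t t' -> tclass t = tclass t'.
Proof. by move=> h; apply/tclassP/teq_rel. Qed.

Lemma proj_X : p (UsetX X) = 1.
Proof. exact: defining_relP (rel_projX R X). Qed.

Lemma proj_0 : p (Uset0 X) = 0.
Proof. exact: defining_relP (rel_proj0 R X). Qed.

Lemma proj_I B C : p (UsetI B C) = p B * p C.
Proof. by rewrite [LHS](defining_relP (rel_projI R B C)) -tclassM. Qed.

Lemma proj_U B C : p (UsetU B C) = p B + p C - p (UsetI B C).
Proof.
rewrite [LHS](defining_relP (rel_projU R B C)) -!tclassD; congr (_ + _).
by rewrite -tclass_opp.
Qed.

Lemma gen_genstar_gen a : s a * s' a * s a = s a.
Proof. by rewrite -[RHS](defining_relP (rel_gen R X a)) -!tclassM. Qed.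

Lemma genstar_gen_genstar a : s' a * s a * s' a = s' a.
Proof. by rewrite -[RHS](defining_relP (rel_genstar R X a)) -!tclassM. Qed.

Definition genstarw w : subshift_alg R X := \prod_(a <- rev w) s' a.
Local Notation sw' := genstarw.

Lemma tclass_twordstar w : tclass (twordstar R X w) = sw' w.
Proof.
rewrite /twordstar /sw'; elim: (rev w) => [|a v IH]; first by rewrite big_nil.
by rewrite big_cons -IH -tclassM.
Qed.

Lemma genw_nil : sw [::] = 1. Proof. exact: big_nil. Qed.
Lemma genw1 a : sw [:: a] = s a. Proof. exact: big_seq1. Qed.
Lemma genw_cat u v : sw (u ++ v) = sw u * sw v. Proof. exact: big_cat. Qed.
Lemma genw_cons a w : sw (a :: w) = s a * sw w. Proof. exact: big_cons. Qed.
Lemma genstarw_nil : sw' [::] = 1. Proof. exact: big_nil. Qed.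
Lemma genstarw1 a : sw' [:: a] = s' a. Proof. exact: big_seq1. Qed.
Lemma genstarw_cons a w : sw' (a :: w) = sw' w * s' a.
Proof. by rewrite /sw' rev_cons -cats1 big_cat big_seq1. Qed.
Lemma genstarw_cat u v : sw' (u ++ v) = sw' v * sw' u.
Proof. by rewrite /sw' rev_cat big_cat. Qed.

Lemma proj_C u v (hu : language X u) (hv : language X v) :
  p (UsetC hu hv) = sw v * sw' u * sw u * sw' v.
Proof.
rewrite -[LHS](defining_relP (rel_C R hu hv)) -!tclassM.
by rewrite !tclass_tword !tclass_twordstar.
Qed.

Lemma proj_idem B : p B * p B = p B.
Proof. by rewrite -proj_I; apply: proj_ext; exact: setIid. Qed.

Lemma proj_comm B C : p B * p C = p C * p B.
Proof. by rewrite -!proj_I; apply: proj_ext; exact: setIC. Qed.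

Lemma proj_sub B C : B `<=` C -> p B * p C = p B.
Proof. by move=> h; rewrite -proj_I; apply/proj_ext/setIidPl. Qed.

Lemma proj_set0 B : (forall x, ~ uset B x) -> p B = 0.
Proof.
by move=> h; rewrite -proj_0; apply: proj_ext; apply/seteqP; split=> // x /h.
Qed.

Lemma proj_compl B : p (UsetD B) = 1 - p B.
Proof.
apply/eqP; rewrite eq_sym subr_eq -proj_X; apply/eqP.
have -> : p (UsetX X) = p (UsetU (UsetD B) B).
  by apply: proj_ext; rewrite /= setDKU //; exact: (inU_sub (usetP B)).
rewrite proj_U (@proj_set0 (UsetI _ _)) ?subr0 // => x [[]].
by [].
Qed.

Lemma proj_split B C : p B = p (UsetI B C) + p (UsetDI B C).
Proof. by rewrite !proj_I proj_compl mulrBr mulr1 addrC subrK. Qed.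

Hypothesis hletters : forall a, language X [:: a].

Let hnil : language X [::] := or_introl erefl.
(** [dom a] and [cyl a] give the projections s_a^* s_a and s_a s_a^*: the points that [a] may
    precede, and the cylinder of [a]. Both are available because each letter lies in the
    language. *)
Let dom a : Uset X := UsetC (hletters a) hnil.
Let cyl a : Uset X := UsetC hnil (hletters a).

Lemma Cset_nilE u v x :
  Cset X u v (wcat v x) <-> X (wcat v x) /\ X (wcat u x).
Proof. by split=> [[y hy /wcat_inj <-]|h] //; exists x. Qed.

Lemma genstar_gen a : s' a * s a = p (dom a).
Proof. by rewrite proj_C genw_nil genstarw_nil mul1r mulr1 genw1 genstarw1. Qed.

Lemma gen_genstar a : s a * s' a = p (cyl a).
Proof. by rewrite proj_C genw_nil genstarw_nil !mulr1 genw1 genstarw1. Qed.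

Lemma cyl_gen a : p (cyl a) * s a = s a.
Proof. by rewrite -gen_genstar gen_genstar_gen. Qed.

Lemma genstar_cyl a : s' a * p (cyl a) = s' a.
Proof. by rewrite -gen_genstar mulrA genstar_gen_genstar. Qed.

Lemma gen_dom a : s a * p (dom a) = s a.
Proof. by rewrite -genstar_gen mulrA gen_genstar_gen. Qed.

Lemma wcat1_inj a b x y : wcat [:: a] x = wcat [:: b] y -> a = b.
Proof. by move=> /(congr1 (@^~ 0%N)). Qed.

Lemma genstar_cyl_neq a b : a <> b -> s' a * p (cyl b) = 0.
Proof.
move=> ab; rewrite -genstar_cyl -mulrA -proj_I proj_set0 ?mulr0 // => x.
by move=> [[y _ <-] [z _ /wcat1_inj/esym]].
Qed.

Lemma genstar_gen_neq a b : a <> b -> s' a * s b = 0.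
Proof. by move=> ab; rewrite -cyl_gen mulrA genstar_cyl_neq ?mul0r. Qed.

(** * Moving projections past generators by means of relative ranges *)

Lemma language_behead a w : language X (a :: w) -> language X w.
Proof.
move=> [//|[x [xX [i e]]]]; right; exists x; split=> //; exists i.+1.
have := congr1 behead e; rewrite /= (iotaDl 1 0) -map_comp => {1}->.
by apply: eq_map => j /=; rewrite -addSnnS.
Qed.

(** Stated existentially because the induction that proves the commutation rule is also what shows
    that the relative range belongs to the Boolean algebra. *)
Lemma proj_gen_ex C a : exists D,
  uset D = rel_range X C [:: a] /\ p C * s a = s a * p D.
Proof.
(* The induction runs over sets; quantifying over every [C'] with underlying set [B] frees it from
   the choice of membership proof. *)
suff H B : inU X B -> exists D, uset D = rel_range X B [:: a] /\
    forall C', uset C' = B -> p C' * s a = s a * p D.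
  by have [D [eD hD]] := H _ (usetP C); exists D; split=> //; exact: hD.
elim=> {B C}.
- move=> u v hu hv; case: v hv => [|b v] hv.
    have [hua|nhua] := pselect (language X (u ++ [:: a])).
      exists (UsetC hua hnil); split=> [|C eC].
        rewrite /= !Cset_r; apply/seteqP; split=> x.
          move=> /(rel_rangeX hX) hx; have hx' := hx; rewrite wcat_cat in hx.
          split; first exact: subshift_wcat hx'.
          by apply/rel_rangeX.
        by move=> [_ /(rel_rangeX hX)]; rewrite -wcat_cat rel_rangeX.
      rewrite (@proj_ext C (UsetC hu hv)) //.
      (* Inserting s_a s_a^* before [s a] and commuting it to the left gives s_a s_(ua)^* s_(ua). *)
      have cC := proj_comm (UsetC hu hv) (cyl a).
      have {1}<- := cyl_gen a.
      rewrite mulrA cC -gen_genstar !proj_C !genw_nil !genstarw_nil !mulr1 !mul1r.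
      by rewrite genstarw_cat genw_cat genw1 genstarw1 !mulrA.
    exists (Uset0 X); split=> [|C eC].
      apply/esym/seteqP; split=> // x; rewrite Cset_r => -[_ /(rel_rangeX hX)].
      by rewrite -wcat_cat => /language_prefix.
    rewrite -cyl_gen mulrA -proj_I proj_0 mulr0 proj_set0 ?mul0r // => x [].
    rewrite eC Cset_r => -[_ uX] [y [yX _] yx]; apply: nhua.
    by apply: (@language_prefix _ _ _ y); rewrite wcat_cat yx.
  have [ab|ab] := pselect (b = a); last first.
    exists (Uset0 X); split=> [|C eC].
      apply/esym/seteqP; split=> // x [_ [y _]]; rewrite wcat_cons.
      by move=> /wcat1_inj.
    rewrite (@proj_ext C (UsetC hu hv)) //.
    by rewrite proj_C genstarw_cons -!mulrA genstar_gen_neq // proj_0 !mulr0.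
  subst b; have hv' := language_behead hv.
  exists (UsetI (UsetC hu hv') (dom a)); split=> [|C eC].
    apply/seteqP; split=> x /=.
      move=> [[y [vyX uyX] <-]]; rewrite Cset_r rel_rangeX // -wcat_cons => h.
      by split=> //; rewrite -wcat_cons; exact/Cset_nilE.
    move=> [xX [y [avyX uyX]]]; rewrite wcat_cons => /wcat_inj e.
    rewrite Cset_r rel_rangeX // -e -wcat_cons; split=> //.
    by apply/Cset_nilE; rewrite e.
  rewrite (@proj_ext C (UsetC hu hv)) //.
  rewrite proj_I -genstar_gen !proj_C !genstarw_cons !genw_cons.
  by rewrite !mulrA.
- exists (dom a); split=> [|C eC]; first by rewrite /= Cset_r.
  by rewrite (@proj_ext C (UsetX X)) // proj_X mul1r gen_dom.
- exists (Uset0 X); split=> [|C eC]; first by apply/seteqP; split=> // x [].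
  by rewrite (@proj_ext C (Uset0 X)) // proj_0 mul0r mulr0.
- move=> B C hB [B' [eB IHB]] hC [C' [eC IHC]].
  exists (UsetI B' C'); split=> [|E eE].
    by rewrite /= eB eC; apply/seteqP; split=> x; rewrite /rel_range /=; tauto.
  rewrite (@proj_ext E (UsetI (USet hB) (USet hC))) //.
  by rewrite !proj_I -mulrA (IHC (USet hC)) // !mulrA IHB.
- move=> B C hB [B' [eB IHB]] hC [C' [eC IHC]].
  exists (UsetU B' C'); split=> [|E eE].
    by rewrite /= eB eC; apply/seteqP; split=> x; rewrite /rel_range /=; tauto.
  rewrite (@proj_ext E (UsetU (USet hB) (USet hC))) //.
  have {}IHB := IHB (USet hB) erefl; have {}IHC := IHC (USet hC) erefl.
  rewrite !proj_U !proj_I mulrBl mulrDl IHB IHC -mulrA IHC mulrA IHB.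
  by rewrite -mulrA mulrBr mulrDr.
(* The complement is taken inside [dom a], which is the relative range of [X] itself. *)
- move=> B hB [B' [eB IHB]].
  exists (UsetDI (dom a) B'); split=> [|E eE].
    rewrite /= eB Cset_r; apply/seteqP; split=> x; rewrite /rel_range /=; tauto.
  rewrite (@proj_ext E (UsetD (USet hB))) //.
  by rewrite proj_I mulrA gen_dom !proj_compl mulrBl mulrBr IHB // mul1r mulr1.
Qed.

Lemma inU_rel_range B w : inU X (rel_range X B w).
Proof.
elim: w B => [|a w IH] B; have BX := inU_sub (usetP B).
  by rewrite rel_range_nil //; exact: usetP.
by have [D [e _]] := proj_gen_ex B a; rewrite -cat1s -rel_range_cat // -e.
Qed.

Definition Urange B w : Uset X := USet (inU_rel_range B w).

Lemma proj_gen B a : p B * s a = s a * p (Urange B [:: a]).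
Proof.
by have [D [e ->]] := proj_gen_ex B a; congr (_ * _); apply: proj_ext.
Qed.

(** Write s_a^* as s_a^* s_a s_a^*: the projection commutes with s_a s_a^*, then passes through s_a
    by [proj_gen]. *)
Lemma genstar_proj B a : s' a * p B = p (Urange B [:: a]) * s' a.
Proof.
rewrite -{1}genstar_gen_genstar -(mulrA (s' a)) gen_genstar -mulrA proj_comm mulrA.
rewrite -[LHS]mulrA -gen_genstar [p B * _]mulrA proj_gen !mulrA genstar_gen.
by rewrite proj_comm -genstar_gen -!mulrA [s' a * (s a * _)]mulrA genstar_gen_genstar.
Qed.

Lemma Urange_cat B u v : p (Urange (Urange B u) v) = p (Urange B (u ++ v)).
Proof. by apply: proj_ext; rewrite /= rel_range_cat //; exact: (inU_sub (usetP B)). Qed.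

Lemma Urange_nil B : p (Urange B [::]) = p B.
Proof. by apply: proj_ext; rewrite /= rel_range_nil //; exact: (inU_sub (usetP B)). Qed.

Lemma proj_genw B w : p B * sw w = sw w * p (Urange B w).
Proof.
elim: w B => [|a w IH] B; first by rewrite genw_nil mulr1 mul1r Urange_nil.
by rewrite genw_cons mulrA proj_gen -!mulrA IH Urange_cat.
Qed.

Lemma genstarw_proj B w : sw' w * p B = p (Urange B w) * sw' w.
Proof.
elim: w B => [|a w IH] B; first by rewrite genstarw_nil mulr1 mul1r Urange_nil.
by rewrite genstarw_cons -mulrA genstar_proj mulrA IH Urange_cat mulrA.
Qed.

(** Induction on the letters covers every word; outside the language the range is empty and the
    product vanishes. *)
Lemma genstarw_genw w : sw' w * sw w = p (Urange (UsetX X) w).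
Proof.
elim: w => [|a w IH]; first by rewrite genstarw_nil genw_nil mulr1 Urange_nil proj_X.
rewrite genstarw_cons genw_cons -mulrA (mulrA (s' a)) genstar_gen.
rewrite proj_genw mulrA IH -proj_I; apply: proj_ext; rewrite /= Cset_r.
apply/seteqP; split=> x; rewrite /rel_range /= (wcat_cons a w x); first tauto.
move=> [xX awxX]; have wxX := subshift_wcat hX awxX.
by do 2!split=> //.
Qed.

Lemma genw_dom w : sw w = sw w * p (Urange (UsetX X) w).
Proof. by rewrite -proj_genw proj_X mul1r. Qed.

(** At the first mismatch the product contains s_a^* s_b = 0; the length condition ensures that
    there is a mismatch. *)
Lemma genstarw_genw_incomp u v :
  (size u <= size v)%N -> ~~ prefix u v -> sw' u * sw v = 0.
Proof.
elim: u v => [|a u IH] [|b v] //= suv; rewrite genstarw_cons genw_cons.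
rewrite -mulrA (mulrA (s' a)); case: eqP => [<- /= h|ab _]; last first.
  by rewrite genstar_gen_neq // mul0r mulr0.
by rewrite genstar_gen proj_genw mulrA IH ?mul0r.
Qed.

Lemma genstarw_genw_cat u v : sw' u * sw (u ++ v) = p (Urange (UsetX X) u) * sw v.
Proof. by rewrite genw_cat mulrA genstarw_genw. Qed.

Local Notation Xr := (Urange (UsetX X)).

(** * Spanning monomials and the removal of starred letters *)

Inductive span (M : subshift_alg R X -> Prop) : subshift_alg R X -> Prop :=
| span_0 : span M 0
| span_D c m x : M m -> span M x -> span M (c *: m + x).

Lemma span_mem (M : subshift_alg R X -> Prop) m : M m -> span M m.
Proof.
by move=> Mm; rewrite -[m]addr0 -[m]scale1r; apply: span_D => //; exact: span_0.
Qed.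

Lemma span_add M x y : span M x -> span M y -> span M (x + y).
Proof.
move=> hx hy; elim: hx => [|c m z Mm _ IH]; first by rewrite add0r.
by rewrite -addrA; exact: span_D.
Qed.

Lemma span_scale M c x : span M x -> span M (c *: x).
Proof.
elim=> [|d m y Mm _ IH]; first by rewrite scaler0; exact: span_0.
by rewrite scalerDr scalerA; exact: span_D.
Qed.

Lemma span_mull M N z x : (forall m, M m -> span N (z * m)) ->
  span M x -> span N (z * x).
Proof.
move=> h; elim=> [|c m y Mm _ IH]; first by rewrite mulr0; exact: span_0.
rewrite mulrDr -subshift_scalerAr; apply: span_add => //.
exact/span_scale/h.
Qed.

Lemma span_mulr M N z x : (forall m, M m -> span N (m * z)) ->
  span M x -> span N (x * z).
Proof.
move=> h; elim=> [|c m y Mm _ IH]; first by rewrite mul0r; exact: span_0.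
rewrite mulrDl -subshift_scalerAl; apply: span_add => //.
exact/span_scale/h.
Qed.

Lemma span_sub M N x : (forall m, M m -> N m) -> span M x -> span N x.
Proof.
move=> h; elim=> [|c m y Mm _ IH]; first exact: span_0.
by apply: span_D => //; exact: h.
Qed.

(** The bound on the starred word is the induction parameter of [starless_multiple]. *)
Definition monomial n m := exists u B v,
  (size v <= n)%N /\ m = sw u * p B * sw' v.

Definition starless m := exists u B, m = sw u * p B.

Lemma monomialW n k x : (n <= k)%N -> span (monomial n) x -> span (monomial k) x.
Proof.
move=> nk; apply: span_sub => _ [u [B [v [hv ->]]]].
by exists u, B, v; split=> //; exact: leq_trans nk.
Qed.

(** Left multiplication by a generator sends monomials to monomials or 0, and only s_a^* can
    lengthen the starred word, by one letter. *)
Lemma monomial_term t n x : span (monomial n) x ->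
  exists k, span (monomial k) (tclass t * x).
Proof.
elim: t n x => [C|a|a|||t IH|t IHt u IHu|t IHt u IHu|c t IH] n x hx.
- exists n; apply: span_mull hx => _ [u [B [v [hv ->]]]].
  rewrite !mulrA proj_genw -[_ * p (Urange C u) * _]mulrA -proj_I.
  by apply: span_mem; exists u, (UsetI (Urange C u) B), v.
- exists n; apply: span_mull hx => _ [u [B [v [hv ->]]]].
  rewrite !mulrA -genw_cons.
  by apply: span_mem; exists (a :: u), B, v.
- exists n.+1; apply: span_mull hx => _ [u [B [v [hv ->]]]].
  case: u => [|b u].
    apply: span_mem; exists [::], (Urange B [:: a]), (v ++ [:: a]).
    rewrite size_cat addn1 genstarw_cat genstarw1 genw_nil !mul1r !mulrA.
    by split=> //; rewrite -genstar_proj.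
  rewrite genw_cons !mulrA; have [<-|ab] := pselect (a = b); last first.
    by rewrite genstar_gen_neq // !mul0r; exact: span_0.
  rewrite genstar_gen proj_genw -[_ * p (Urange _ u) * _]mulrA -proj_I.
  apply: span_mem; exists u, (UsetI (Urange (dom a) u) B), v.
  by split=> //; exact: leqW.
- exists 0%N; rewrite (_ : tclass _ = 0) // mul0r; exact: span_0.
- by exists n; rewrite (_ : tclass _ = 1) // mul1r.
- have [k hk] := IH _ _ hx; exists k; rewrite -tclass_opp.
  change (aopp (tclass t)) with (- tclass t).
  by rewrite mulNr -scaleN1r; exact: span_scale.
- have [k hk] := IHt _ _ hx; have [l hl] := IHu _ _ hx; exists (maxn k l).
  rewrite -tclassD mulrDl; apply: span_add.
    exact: monomialW (leq_maxl _ _) hk.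
  exact: monomialW (leq_maxr _ _) hl.
- have [k hk] := IHu _ _ hx; have [l hl] := IHt _ _ hk; exists l.
  by rewrite -tclassM -mulrA.
- have [k hk] := IH _ _ hx; exists k.
  by rewrite -tclassZ -subshift_scalerAl; exact: span_scale.
Qed.

Lemma span_monomial x : exists n, span (monomial n) x.
Proof.
have h1 : span (monomial 0) 1.
  apply: span_mem; exists [::], (UsetX X), [::].
  by rewrite genw_nil genstarw_nil proj_X !mulr1.
by have := monomial_term (trepr x) h1; rewrite mulr1 treprK.
Qed.

Lemma genw_proj_I u B C : sw u * p B * p C = sw u * p (UsetI B C).
Proof. by rewrite -mulrA -proj_I. Qed.

Lemma starless_proj C x : span starless x -> span starless (x * p C).
Proof.
apply: span_mulr => _ [u [B ->]]; rewrite genw_proj_I.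
by apply: span_mem; exists u, (UsetI B C).
Qed.

(** The rightmost factor of s_v^* is the star of the first letter of [v], so [s a] either cancels it
    or kills the monomial; for empty [v] it is absorbed into [u]. *)
Lemma monomial_gen n a x :
  span (monomial n.+1) x -> span (monomial n) (x * s a).
Proof.
apply: span_mulr => _ [u [B [v [hv ->]]]]; apply: span_mem.
case: v hv => [|b v] hv.
  exists (u ++ [:: a]), (Urange B [:: a]), [::]; split=> //.
  by rewrite genstarw_nil !mulr1 -mulrA proj_gen genw_cat genw1 mulrA.
rewrite genstarw_cons -!mulrA; have [->|ab] := pselect (b = a); last first.
  exists [::], (Uset0 X), [::]; split=> //.
  by rewrite genstar_gen_neq // proj_0 !(mulr0, mul0r).
rewrite genstar_gen genstarw_proj.
by exists u, (UsetI B (Urange (dom a) v)), v; rewrite proj_I !mulrA.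
Qed.

Lemma span_monomial_proj n x : span (monomial n) x -> exists D,
  (forall z, (forall a, z * s a = 0) -> z * p D = z) /\
  span starless (x * p D).
Proof.
elim=> [|c _ x' [u [B [v [_ ->]]]] _ [D [hD hx]]].
  by exists (UsetX X); split=> [z _|]; rewrite ?mul0r ?proj_X ?mulr1 //; exact: span_0.
case: v => [|b v].
  exists D; split=> //; rewrite mulrDl -subshift_scalerAl genstarw_nil mulr1.
  rewrite genw_proj_I; apply: span_D => //.
  by exists u, (UsetI B D).
exists (UsetI D (UsetD (cyl b))); rewrite proj_I proj_compl -gen_genstar.
split=> [z hz|]; first by rewrite mulrA hD // mulrBr mulr1 mulrA hz mul0r subr0.
rewrite mulrDl -subshift_scalerAl gen_genstar -proj_compl -proj_I.
have -> : p (UsetI D (UsetD (cyl b))) = p (UsetD (cyl b)) * p D.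
  by rewrite proj_I proj_comm.
rewrite genstarw_cons -!mulrA [s' b * _]mulrA proj_compl mulrBr mulr1 genstar_cyl.
rewrite subrr !(mulr0, mul0r) scaler0 add0r -proj_compl proj_comm mulrA.
exact: starless_proj.
Qed.

Lemma starless_multiple n x : span (monomial n) x -> x <> 0 ->
  exists nu, x * nu <> 0 /\ span starless (x * nu).
Proof.
elim: n x => [|n IH] x hx x0.
  exists 1; rewrite mulr1; split=> //; apply: span_sub hx => _ [u [B [v [hv ->]]]].
  by exists u, B; case: v hv => // _; rewrite genstarw_nil mulr1.
have [[a xa]|h] := pselect (exists a, x * s a <> 0).
  have [nu []] := IH _ (monomial_gen a hx) xa.
  by rewrite -mulrA => ? ?; exists (s a * nu).
have [D [hD hxD]] := span_monomial_proj hx; exists (p D); split=> //.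
rewrite hD // => a; apply: contrapT => xa; apply: h; by exists a.
Qed.

(** * Reduction to a non-zero constant term plus terms with non-empty words *)

Definition combo (c : seq (R * seq A)) : subshift_alg R X :=
  \sum_(i <- c) i.1 *: sw i.2.

(** The monomials are treated one at a time, and [c] collects those already freed of their
    projection. Each new set [B'] cuts [D] in two, and the element stays non-zero on one piece:
    inside [B'] the monomial joins [c], outside it vanishes. *)
Lemma starless_refine x c D : span starless x ->
  (forall i, i \in c -> uset D `<=` Xr i.2) ->
  (combo c + x) * p D <> 0 ->
  exists D' c', [/\ uset D' `<=` uset D,
    forall i, i \in c' -> uset D' `<=` Xr i.2,
    (combo c + x) * p D' = combo c' * p D' & combo c' * p D' <> 0].
Proof.
move=> hx; elim: hx c D => [|g m x' [u [B ->]] _ IH] c D hc z0.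
  by rewrite addr0 in z0 *; exists D, c; split.
(* Shrinking to the domain of [sw u] leaves the monomial unchanged and preserves the invariant on
   [c] when [u] joins it. *)
pose B' := UsetI B (Xr u).
have mB : sw u * p B = sw u * p B'.
  by rewrite /B' proj_I proj_comm mulrA -genw_dom.
rewrite mB in z0 *; set z := combo c + _ in z0 *.
suff [D1 [c1 [D1D zD1 hc1 zD10]]] : exists D1 c1, [/\ uset D1 `<=` uset D,
    z * p D1 = (combo c1 + x') * p D1, forall i, i \in c1 -> uset D1 `<=` Xr i.2
    & z * p D1 <> 0].
  rewrite zD1 in zD10; have [D2 [c2 [D21 hc2 e ne]]] := IH _ _ hc1 zD10.
  exists D2, c2; split=> //; first exact: subset_trans D21 D1D.
  by rewrite -e -(proj_sub D21) proj_comm !mulrA zD1.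
have [h|h] := pselect (z * p (UsetI D B') = 0); last first.
  exists (UsetI D B'), ((g, u) :: c); split=> //.
  - exact: subIsetl.
  - rewrite /combo big_cons /= -/(combo c) /z [_ + combo c]addrC -addrA.
    rewrite !mulrDl; congr (_ + (_ + _)); rewrite -!subshift_scalerAl.
    rewrite -mulrA proj_comm (@proj_sub _ B') //; exact: subIsetr.
  - move=> i; rewrite in_cons => /orP[/eqP->|/hc h'].
      by move=> y [_ []].
    by apply: subset_trans h'; exact: subIsetl.
exists (UsetDI D B'), c; split=> //.
- exact: subIsetl.
- rewrite /z !mulrDl -subshift_scalerAl -mulrA -proj_I (@proj_set0 (UsetI _ _)).
    by rewrite mulr0 scaler0 add0r.
  by move=> y [? [? []]].
- by move=> i /hc h'; apply: subset_trans h'; exact: subIsetl.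
- by move=> h'; apply: z0; rewrite (proj_split D B') mulrDr h h' addr0.
Qed.

(** Coefficients of equal words are summed and zero sums dropped; every remaining word still comes
    from [c], so it keeps the domain condition. *)
Lemma combo_collect c : exists W (g : seq A -> R),
  [/\ uniq W, forall w, w \in W -> g w <> 0,
      forall w, w \in W -> exists2 i, i \in c & i.2 = w
    & combo c = \sum_(w <- W) g w *: sw w].
Proof.
pose g w := \sum_(i <- c | i.2 == w) i.1.
pose V := undup [seq i.2 | i <- c].
exists [seq w <- V | g w != 0], g; split.
- exact/filter_uniq/undup_uniq.
- by move=> w; rewrite mem_filter => /andP[/eqP].
- move=> w; rewrite mem_filter mem_undup => /andP[_ /mapP[i ic ->]].
  by exists i.
rewrite big_filter big_mkcond /=.
rewrite (eq_bigr (fun w => g w *: sw w)); last first.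
  by move=> w _; case: eqP => //= ->; rewrite scale0r.
rewrite (eq_bigr (fun w => \sum_(i <- c) if i.2 == w then i.1 *: sw w else 0));
  last first.
  by move=> w _; rewrite /g scaler_suml big_mkcond.
rewrite exchange_big /= /combo big_seq [RHS]big_seq; apply: eq_bigr => i ic.
rewrite (bigD1_seq i.2) ?undup_uniq //=; last by rewrite mem_undup map_f.
rewrite eqxx big1 ?addr0 // => w; by case: eqVneq.
Qed.

Lemma starless_reduce x : span starless x -> x <> 0 ->
  exists mu nu (D : Uset X) g (c : seq (R * seq A)) t,
  [/\ g <> 0, uset D t, forall i, i \in c -> i.1 <> 0 /\ i.2 <> [::]
    & mu * x * nu = g *: p D + \sum_(i <- c) i.1 *: (sw i.2 * p D)].
Proof.
move=> hx x0.
have [||D [c [_ hc]]] := @starless_refine x [::] (UsetX X) hx; first by [].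
  by rewrite /combo big_nil add0r proj_X mulr1.
rewrite /combo big_nil add0r -/(combo c) => xD cD.
have [t Dt] : exists t, uset D t.
  apply: contrapT => h; apply: cD; rewrite proj_set0 ?mulr0 // => t Dt.
  by apply: h; exists t.
have [W [g [Wu gW Wc cW]]] := combo_collect c.
have hW w : w \in W -> uset D `<=` Xr w by move=> /Wc[i /hc h <-].
(* Since [u] is shortest, s_u^* kills each word not extending [u] and strips [u] from the others;
   distinctness of the words leaves a non-empty rest. *)
have [u uW umin] : exists2 u, u \in W & forall w, w \in W -> (size u <= size w)%N.
  have exn : exists n, has (fun w => size w == n) W.
    case: (W) cW => [cW|w W' _]; last by exists (size w); rewrite /= eqxx.
    by case: cD; rewrite cW big_nil mul0r.
  case: (ex_minnP exn) => n /hasP[u uW /eqP <-] h; exists u => // w wW.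
  by apply: h; apply/hasP; exists w.
have uD : p (Xr u) * p D = p D by rewrite proj_comm proj_sub //; exact: hW.
have [c' hc' e] : exists2 c' : seq (R * seq A),
    forall i, i \in c' -> i.1 <> 0 /\ i.2 <> [::] &
    sw' u * (\sum_(w <- rem u W) g w *: sw w) * p D =
    \sum_(i <- c') i.1 *: (sw i.2 * p D).
  have : {subset rem u W <= [pred w | (w \in W) && (w != u)]}.
    by move=> w; rewrite mem_rem_uniq // !inE andbC.
  elim: (rem u W) => [|w V IH] hV.
    by exists [::] => //; rewrite !big_nil mulr0 mul0r.
  have [|c1 hc1 e1] := IH; first by move=> v vV; apply: hV; rewrite in_cons vV orbT.
  have /andP[wW /eqP wu] := hV w (mem_head _ _).
  rewrite big_cons mulrDr mulrDl e1 -subshift_scalerAr -subshift_scalerAl.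
  case: (boolP (prefix u w)) => [/prefixP[v wE]|np]; last first.
    exists c1 => //.
    by rewrite (genstarw_genw_incomp (umin _ wW) np) mul0r scaler0 add0r.
  exists ((g w, v) :: c1) => [i|].
    rewrite in_cons => /orP[/eqP->|/hc1//]; split; first exact: gW.
    by move=> v0; apply: wu; rewrite wE [v]v0 cats0.
  rewrite big_cons /=; congr (_ *: _ + _).
  rewrite wE genstarw_genw_cat proj_genw -mulrA proj_comm proj_sub //.
  move=> y Dy; have := hW _ wW y Dy; rewrite wE /= => -[yX].
  rewrite wcat_cat => h; split=> //; split=> //.
  exact: (subshift_wcat hX h).
exists (sw' u), (p D), D, (g u), c', t; split=> //; first exact: gW.
rewrite -mulrA xD mulrA cW (perm_big _ (perm_to_rem uW)) big_cons mulrDr mulrDl e.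
congr (_ + _); rewrite -subshift_scalerAr -subshift_scalerAl genstarw_genw.
by rewrite uD.
Qed.

(** * Compression by cylinders *)

Lemma prefix_set t N : X t -> exists C : Uset X,
  forall x, uset C x <-> X x /\ forall k, (k < N)%N -> x k = t k.
Proof.
move=> Xt; have Xwt : X (wcat (prefix_of t N) (shiftn N t)).
  by rewrite wcat_prefix_of.
exists (UsetC hnil (language_prefix Xwt)) => x; split=> /=.
  move=> [y [wyX yX] <-]; split=> // k kN.
  by rewrite wcatE size_prefix_of kN nth_prefix_of.
move=> [Xx xt]; have e : wcat (prefix_of t N) (shiftn N x) = x.
  rewrite -[RHS](wcat_prefix_of x N); congr wcat.
  by apply/eq_in_map => k; rewrite mem_iota => /xt.
exists (shiftn N x) => //=; rewrite e wcat_nil; split=> //.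
by apply: (@subshift_wcat _ _ hX (prefix_of t N)); rewrite e.
Qed.

(** Compressing s_w by [D'] keeps only the points [y] of [D'] for which [wcat w y] is again in
    [D']. *)
Lemma cut_polynomial (D D' : Uset X) g (c : seq (R * seq A)) :
  uset D' `<=` uset D ->
  p D' * (g *: p D + \sum_(i <- c) i.1 *: (sw i.2 * p D)) * p D' =
  g *: p D' + \sum_(i <- c) i.1 *: (sw i.2 * p (UsetI (Urange D' i.2) D')).
Proof.
move=> DD; have eD : p D * p D' = p D' by rewrite proj_comm proj_sub.
rewrite mulrDr mulrDl -subshift_scalerAr -subshift_scalerAl -mulrA eD proj_idem.
congr (_ + _); rewrite mulr_sumr mulr_suml; apply: eq_bigr => i _.
rewrite -subshift_scalerAr -subshift_scalerAl; congr (_ *: _).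
by rewrite mulrA -[LHS]mulrA eD proj_genw -mulrA -proj_I.
Qed.

End Relations.

Theorem theorem4p7 (R : comPzRingType) (A : pointedType) (X : set (nat -> A))
    (hX : subshift X) (hletters : forall a : A, language X [:: a])
    (x : subshift_alg R X) (hx : x <> 0) :
  exists mu nu : subshift_alg R X,
    mu * x * nu <> 0 /\
    ((exists (D : Uset X) (g : R), g <> 0 /\ mu * x * nu = g *: proj R D)
     \/
     (exists (B : Uset X) (b : seq A) (k : nat) (g : nat -> R) (q : nat -> nat),
        [/\ minimal_cycle_without_exit B b,
            (1 <= k)%N,
            forall i : nat, (1 <= i <= k)%N -> g i <> 0,
            forall i : nat, (2 <= i <= k)%N -> q i <> 0%N
          & mu * x * nu =
            g 1%N *: proj R B +
            \sum_(2 <= i < k.+1) g i *: (genw R X (wpow b (q i)) * proj R B)])).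
Proof.
have [n xn] := span_monomial hX hletters x.
have [nu1 [x1 sx1]] := starless_multiple hX hletters xn hx.
have [mu [nu2 [D [g [c [t [g0 Dt hc e]]]]]]] := starless_reduce hX hletters sx1 x1.
have cut D' : uset D' `<=` uset D ->
    proj R D' * mu * x * (nu1 * nu2 * proj R D') =
    g *: proj R D' + \sum_(i <- c) i.1 *:
      (genw R X i.2 * proj R (UsetI (Urange R hX hletters D' i.2) D')).
  by move=> /(cut_polynomial hX hletters g c) <-; rewrite -e !mulrA.
have DX := inU_sub (usetP D).
have [[u [Du hu]]|hper] := pselect (exists u, uset D u /\
    forall w, w \in [seq i.2 | i <- c] -> u <> winfty w).
  have [N hN] := separating_length [seq i.2 | i <- c] u.
  have [C hC] := prefix_set hX N (DX _ Du).
  pose D' := UsetI D C.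
  have eD' : proj R D' * mu * x * (nu1 * nu2 * proj R D') = g *: proj R D'.
    rewrite cut; last exact: subIsetl.
    rewrite big_seq big1 ?addr0 // => i ic.
    (* A point [y] with both [y] and [wcat i.2 y] in the cylinder would force [u] to equal
       [winfty i.2]. *)
    rewrite proj_set0 ?mulr0 ?scaler0 // => y /= [[_ [_ /hC[_ iyu]]] [_ /hC[_ yu]]].
    apply: (hu i.2 (map_f _ ic)); apply: hN; first exact: map_f.
    by apply: winfty_prefix yu iyu; have [] := hc _ ic.
  exists (proj R D' * mu), (nu1 * nu2 * proj R D'); rewrite eD'; split.
    have := @neq0_of_degree0 _ _ _ hX g D' [::] u g0.
    by rewrite big_nil addr0; apply=> //; split=> //; apply/hC; split=> //; exact: DX.
  by left; exists D', g.
have per u : uset D u -> exists2 w, w \in [seq i.2 | i <- c] & u = winfty w.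
  move=> Du; apply: contrapT => h; apply: hper; exists u; split=> // w wc uw.
  by apply: h; exists w.
have [w0 /mapP[i0 i0c w0E] tw0] := per t Dt.
have w00 : w0 <> [::] by rewrite w0E; have [] := hc _ i0c.
have w0t : wcat w0 t = t by rewrite tw0 wcat_winfty.
have [b [b0 bt [bmin bpow]]] := primitive_root w00 w0t.
have [N hN] := separating_length [seq i.2 | i <- c] t.
have [C hC] := prefix_set hX N (DX _ Dt).
pose D' := UsetI D C.
have D't : uset D' t by split=> //; apply/hC; split=> //; exact: DX.
(* Every point of [D] is some [winfty w] with [w] from the finite list, and [N] separates [t] from
   those different from it. *)
have D'E : uset D' = [set t].
  apply/seteqP; split=> [y [Dy /hC[_ yt]]|y ->] //=.
  have [w wc yw] := per y Dy.
  by rewrite yw; apply/esym/hN => // k kN; rewrite -yt // yw.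
pose c' := [seq i <- c | `[< wcat i.2 t = t >]].
have hc' i : i \in c' -> i.1 <> 0 /\ i.2 <> [::].
  by rewrite mem_filter => /andP[_ /hc].
have pc' i : i \in c' -> exists2 q, q <> 0%N & i.2 = wpow b q.
  rewrite mem_filter => /andP[/asboolP it /hc[_ i2]]; exact: bpow.
have sb : (0 < size b)%N by case: (b) b0.
(* Recovers the exponent of a power of [b] from its length. *)
pose q (w : seq A) := (size w %/ size b)%N.
have qE i : i \in c' -> q i.2 <> 0%N /\ wpow b (q i.2) = i.2.
  by move=> /pc'[k k0 ->]; rewrite /q size_wpow mulnK.
have eD' : proj R D' * mu * x * (nu1 * nu2 * proj R D') =
    g *: proj R D' + \sum_(i <- c') i.1 *: (genw R X i.2 * proj R D').
  rewrite cut; last exact: subIsetl.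
  congr (_ + _); rewrite big_filter [RHS]big_mkcond; apply: eq_bigr => i _.
  (* On the single point [t], the set attached to [i.2] is all of [D'] if [i.2] fixes [t], and empty
     otherwise. *)
  case: asboolP => /= it.
    congr (i.1 *: (genw R X i.2 * _)); apply: proj_ext.
    apply/seteqP; split=> [y []//|y D'y].
    have -> : y = t by rewrite D'E in D'y.
    by split=> //; split; rewrite ?it //; exact: DX.
  rewrite proj_set0 ?mulr0 ?scaler0 // => y [[_ D'iy] D'y]; apply: it.
  by rewrite D'E in D'iy D'y; rewrite -[in LHS]D'y.
exists (proj R D' * mu), (nu1 * nu2 * proj R D'); split.
  rewrite eD'; apply: neq0_of_degree0 D't _ => // w /mapP[i /hc'[_ i2] ->] //.
(* Index 1 carries [g] and index [i] at least 2 carries entry [i - 2] of [c'], so there are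
   [(size c').+1] terms; the default [d] is not reached for indices from 2 to that number. *)
right; pose d : R * seq A := (0, [::]).
exists D', b, (size c').+1,
  (fun i => if i == 1%N then g else (nth d c' (i - 2)).1),
  (fun i => q (nth d c' (i - 2)).2).
have nthc' i : (2 <= i <= (size c').+1)%N -> nth d c' (i - 2) \in c'.
  by case: i => [|[|i]] //= ?; rewrite mem_nth // !subSS subn0.
split=> //.
- have tb : t = winfty b by exact: winftyE.
  split; [split; last by rewrite D'E -tb|].
  + split=> //; first by apply: (@language_prefix _ _ _ t); rewrite bt; exact: DX.
      by rewrite D'E => /seteqP[/(_ t erefl)].
    by rewrite D'E => y ->; split; rewrite ?bt //; exact: DX.
  (* A proper root [v] of [b] would also fix [t], against the choice of [b] as shortest. *)
  + move=> [v [_ v1 vb [k [k2 bE]]]].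
    have v0 : v <> [::] by case: (v) v1.
    have /(bmin v v0) : wcat v t = t.
      by rewrite tb bE winfty_wpow ?wcat_winfty //; exact: ltnW.
    by rewrite leqNgt vb.
- move=> i /andP[i1 ik]; case: eqP => // /eqP i1'.
  have /hc'[] // : nth d c' (i - 2) \in c'.
  by apply: nthc'; rewrite ik andbT ltn_neqAle eq_sym i1'.
- by move=> i /nthc'/qE[].
- rewrite eD' eqxx; congr (_ + _).
  rewrite big_add1 /= (big_nth d) big_add1 /= [RHS]big_nat [LHS]big_nat.
  apply: eq_bigr => i hi.
  by rewrite /= !subSS subn0; have [_ ->] := qE _ (mem_nth d hi).
Qed.
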